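(* Let $Y$ be a Fréchet space with a continuous norm. Then $\omega\oplus Y$ satisfies the Invariant Subspace Property.
   Context: A Fréchet space $(X,(p_j)_{j\ge1})$ is a topological vector space whose topology is induced by a non-decreasing and separating sequence of seminorms $(p_j)_{j\ge 1}$ such that the metric $d(x,y)=\sum_{j\ge 1}2^{-j}\min\{1,p_j(x-y)\}$ is complete. ''With a continuous norm'' means that there exists a norm on $Y$ which is continuous for the topology of $Y$. The space $\omega$ is the space of all complex sequences $(x_n)_n$ endowed with the seminorms $p_j(x)=\max_{n\le j}|x_n|$, and $\omega\oplus Y$ is the topological direct sum (with $Y$ over the same scalar field). An operator (continuous linear map) $T:X\to X$ possesses a non-trivial invariant subspace if there exists a closed subspace $M$ of $X$, different from $\{0\}$ and $X$, such that $TM\subset M$. The space $X$ satisfies the Invariant Subspace Property if every continuous linear operator on $X$ possesses a non-trivial invariant subspace. *)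

(* Defs.v *)
From HB Require Import structures.
From mathcomp Require Import all_boot all_order all_algebra.
From mathcomp Require Export complex.
From mathcomp Require Import all_classical all_reals all_analysis.
From mathcomp Require Import lra.
Import numFieldNormedType.Exports.
Import Order.TTheory GRing.Theory Num.Theory.

Set Implicit Arguments.
Unset Strict Implicit.
Unset Printing Implicit Defensive.

Local Open Scope classical_set_scope.
Local Open Scope convex_scope.
Local Open Scope ring_scope.

Local Notation normc := Normc.normc.

Lemma normc_ge0 (R : realType) (a : R[i]) : 0 <= normc a.
Proof. by case: a => a b; exact: sqrtr_ge0. Qed.

Lemma normcD_le (R : realType) (a b : R[i]) : normc (a + b) <= normc a + normc b.
Proof. exact: le_normcD. Qed.

Lemma normc_normr (R : realType) (a : R[i]) : `|a| = (normc a)%:C%C.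
Proof. by case: a => a b; rewrite normc_def. Qed.

Lemma normcB_sym (R : realType) (a b : R[i]) : normc (a - b) = normc (b - a).
Proof. by rewrite -opprB; exact: normcN. Qed.

Section Seminorms.
Context {R : realType}.

(* The norm of the field [R[i]] takes its values in [R[i]]; [normc] is the same
   modulus with values in [R]. *)
Record is_seminorm (E : lmodType R[i]) (q : E -> R) : Prop := {
  seminorm_ge0 : forall x, 0 <= q x ;
  seminormD : forall x y, q (x + y) <= q x + q y ;
  seminormZ : forall (a : R[i]) x, q (a *: x) = normc a * q x }.

Definition is_norm (E : lmodType R[i]) (q : E -> R) : Prop :=
  is_seminorm q /\ forall x, q x = 0 -> x = 0.

(* Seminorm sequences are indexed from 0: [p j] stands for the usual p_{j+1}. *)

Definition nondecreasing_seminorms (E : lmodType R[i]) (p : nat -> E -> R) :=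
  forall j k x, (j <= k)%N -> p j x <= p k x.

Definition separating_seminorms (E : lmodType R[i]) (p : nat -> E -> R) :=
  forall x, (forall j, p j x = 0) -> x = 0.

(* For a nondecreasing sequence, the balls of the single seminorms [p j] already
   form a basis of neighbourhoods: finite intersections are not needed. *)
Definition seminorm_nbhs (E : lmodType R[i]) (p : nat -> E -> R) (x : E) :
    set_system E :=
  [set A | exists j, exists2 e : R, 0 < e & [set y | p j (y - x) < e] `<=` A].

Definition frechet_dist (E : lmodType R[i]) (p : nat -> E -> R) (x y : E) : R :=
  limn (series (fun j => 2^-1 ^+ j.+1 * Num.min 1 (p j (x - y)))).

Definition dist_complete (T : Type) (d : T -> T -> R) : Prop :=
  forall u : nat -> T,
    (forall e : R, 0 < e -> exists N : nat,
       forall m n : nat, (N <= m)%N -> (N <= n)%N -> d (u m) (u n) < e) ->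
  exists l : T, forall e : R, 0 < e -> exists N : nat,
    forall n : nat, (N <= n)%N -> d (u n) l < e.

(* The uniformity carried by a [tvsType] is only required to induce its topology,
   so completeness is stated for [frechet_dist]. *)
Record is_frechet (X : tvsType R[i]) (p : nat -> X -> R) : Prop := {
  frechet_seminorm : forall j, is_seminorm (p j) ;
  frechet_nondecreasing : nondecreasing_seminorms p ;
  frechet_separating : separating_seminorms p ;
  frechet_topology : forall x : X, nbhs x = seminorm_nbhs p x ;
  frechet_complete : dist_complete (frechet_dist p) }.

Definition has_continuous_norm (X : tvsType R[i]) : Prop :=
  exists2 q : X -> R, is_norm q & continuous q.

End Seminorms.

Definition invariant_subspace (K : numFieldType) (X : tvsType K) (T : X -> X)
    (M : set X) :=
  [/\ GRing.submod_closed (mem M), closed M & T @` M `<=` M].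

Definition invariant_subspace_property (K : numFieldType) (X : tvsType K) : Prop :=
  forall T : {linear X -> X}, continuous T ->
  exists M : set X, [/\ invariant_subspace T M, M != [set 0] & M != [set: X]].

Lemma seminorm0 (R : realType) (E : lmodType R[i]) (q : E -> R) :
  is_seminorm q -> q 0 = 0.
Proof.
by case=> _ _ qZ; rewrite -(scale0r (0 : E)) qZ Normc.normc0 mul0r.
Qed.

Section SeminormTopology.
Context {R : realType} (E : lmodType R[i]) (p : nat -> E -> R).
Hypothesis p_semi : forall j, is_seminorm (p j).
Hypothesis p_mono : nondecreasing_seminorms p.

Let pD j x y : p j (x + y) <= p j x + p j y.
Proof. exact: seminormD. Qed.

Let pZ j a x : p j (a *: x) = normc a * p j x.
Proof. exact: seminormZ. Qed.

Let p0 j : p j 0 = 0.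
Proof. exact: seminorm0. Qed.

Let p_ge0 j x : 0 <= p j x.
Proof. exact: seminorm_ge0. Qed.

Lemma seminorm_nbhs_filter (x : E) : ProperFilter (seminorm_nbhs p x).
Proof.
apply: Build_ProperFilter_ex => [A [j [e e0 eA]]|].
  by exists x; apply: eA; rewrite /= subrr p0.
split.
- by exists 0%N, 1.
- move=> A B [j [e e0 eA]] [k [f f0 fB]].
  exists (maxn j k), (Num.min e f); first by rewrite lt_min e0.
  move=> y /=; rewrite lt_min => /andP[ye yf]; split.
    by apply: eA => /=; apply: le_lt_trans ye; apply: p_mono; exact: leq_maxl.
  by apply: fB => /=; apply: le_lt_trans yf; apply: p_mono; exact: leq_maxr.
- move=> A B AB [j [e e0 eA]]; exists j, e => //; exact: subset_trans AB.
Qed.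

Lemma seminorm_ball_nbhs (x z : E) j e : p j (z - x) < e ->
  seminorm_nbhs p z [set y | p j (y - x) < e].
Proof.
move=> ze; exists j, (e - p j (z - x)); first by rewrite subr_gt0.
move=> y /=; rewrite ltrBrDr => yz; apply: le_lt_trans yz.
by rewrite -(subrKA z) pD.
Qed.

Lemma seminorm_nbhs_singleton (x : E) A : seminorm_nbhs p x A -> A x.
Proof. by move=> [j [e e0 eA]]; apply: eA; rewrite /= subrr p0. Qed.

Lemma seminorm_nbhs_nbhs (x : E) A :
  seminorm_nbhs p x A -> seminorm_nbhs p x ((seminorm_nbhs p)^~ A).
Proof.
move=> [j [e e0 eA]]; exists j, e => // z /seminorm_ball_nbhs[k [f f0 fA]].
exists k, f => //; exact: subset_trans eA.
Qed.

Lemma seminorm_add_nbhs (x y : E) A : seminorm_nbhs p (x + y) A ->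
  exists B C, [/\ seminorm_nbhs p x B, seminorm_nbhs p y C &
    forall u v, B u -> C v -> A (u + v)].
Proof.
move=> [j [e e0 eA]]; have e2 : 0 < e / 2 by rewrite divr_gt0.
exists [set u | p j (u - x) < e / 2], [set u | p j (u - y) < e / 2].
split; [by exists j, (e / 2)|by exists j, (e / 2)|move=> u v /= ux vy].
apply: eA => /=; rewrite opprD addrACA (le_lt_trans (pD _ _ _))//.
by rewrite [e]splitr ltrD.
Qed.

Lemma seminorm_scale_nbhs (k : R[i]) (x : E) A : seminorm_nbhs p (k *: x) A ->
  exists2 d : R, 0 < d & exists2 B, seminorm_nbhs p x B &
    forall l u, normc (k - l) < d -> B u -> A (l *: u).
Proof.
move=> [j [e e0 eA]].
have px0 := p_ge0 j x.
have k0 : 0 <= normc k by rewrite normc_ge0.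
set d := Num.min 1 (e / 2 / (p j x + 1)).
have d0 : 0 < d by rewrite lt_min ltr01 !divr_gt0//; lra.
set f := e / 2 / (normc k + 1).
have f0 : 0 < f by rewrite !divr_gt0//; lra.
exists d => //; exists [set u | p j (u - x) < f]; first by exists j, f.
move=> l u kl /= ux; apply: eA => /=.
have -> : l *: u - k *: x = l *: (u - x) + (l - k) *: x.
  by rewrite scalerBr scalerBl addrA subrK.
apply: le_lt_trans (pD _ _ _) _; rewrite !pZ.
have lk : normc (l - k) < d by rewrite normcB_sym.
have lk1 : normc l <= normc k + 1.
  rewrite -(subrK k l) (le_trans (normcD_le _ _))// addrC lerD2l.
  by apply: ltW; apply: lt_le_trans lk _; rewrite ge_min lexx.
have h1 : normc l * p j (u - x) < e / 2.
  apply: (@le_lt_trans _ _ ((normc k + 1) * p j (u - x))).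
    by rewrite ler_wpM2r.
  by rewrite mulrC -ltr_pdivlMr//; lra.
have h2 : normc (l - k) * p j x <= e / 2.
  apply: (@le_trans _ _ (d * (p j x + 1))).
    apply: ler_pM => //; [exact: normc_ge0|exact: ltW|lra].
  by rewrite -ler_pdivlMr ?ge_min ?lexx ?orbT//; lra.
lra.
Qed.

Lemma seminorm_ball_convex (x : E) j e :
  convex_set [set y | p j (y - x) < e].
Proof.
move=> y z l; rewrite !inE /= => ye ze.
have [t [t0 t1 tE]] : exists t : R, [/\ 0 <= t, t <= 1 & l%:num = (t%:C)%C].
  have l0 : 0 <= l%:num by exact: ge0.
  have l1 : l%:num <= 1 by exact: le1.
  move: l1 l0; case: (l%:num) => a b; rewrite !lecE /= => /andP[/eqP b0 a1] /andP[_ a0].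
  by exists a; rewrite -b0.
rewrite [y <| _ |> z]/((l%:num : R[i]) *: (y : E) + (1 - l%:num) *: (z : E)).
rewrite tE.
have -> : (t%:C)%C *: (y : E) + (1 - (t%:C)%C) *: (z : E) - x =
    (t%:C)%C *: (y - x : E) + ((1 - t)%:C)%C *: (z - x : E).
  rewrite !scalerBr addrACA -opprD -scalerDl rmorphB rmorph1.
  by rewrite addrCA subrr addr0 scale1r.
apply: le_lt_trans (pD _ _ _) _; rewrite !pZ.
have nE (u : R) : 0 <= u -> normc (u%:C)%C = u.
  by move=> u0; rewrite /= expr0n/= addr0 sqrtr_sqr ger0_norm.
rewrite !nE ?subr_ge0//.
set m := Num.max (p j (y - x)) (p j (z - x)).
apply: (@le_lt_trans _ _ (t * m + (1 - t) * m)); last first.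
  by rewrite -mulrDl addrC subrK mul1r gt_max ye.
by rewrite lerD// ler_wpM2l ?subr_ge0// le_max lexx ?orbT.
Qed.

End SeminormTopology.

(* The space of all complex sequences, with x_1, x_2, ... indexed from 0. *)
Definition omega (R : realType) : Type := nat -> R[i]^o.

Definition omega_seminorm (R : realType) (j : nat) (x : omega R) : R :=
  \big[Num.max/0]_(n < j.+1) normc (x n).

Section Omega.
Context {R : realType}.
Local Notation omega := (omega R).
Local Notation p := (@omega_seminorm R).

HB.instance Definition _ := GRing.Lmodule.on omega.

Lemma omega_seminorm_ge0 j (x : omega) : 0 <= p j x.
Proof. exact: bigmax_ge_id. Qed.

Lemma omega_seminormP j (x : omega) (e : R) :
  reflect (0 <= e /\ forall n, (n <= j)%N -> normc (x n) <= e) (p j x <= e).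
Proof.
rewrite /omega_seminorm; apply: (iffP (bigmax_leP _ _ _ _)) => -[e0 xe]; split => //.
  by move=> n nj; exact: (xe (Ordinal (nj : (n < j.+1)%N))).
by move=> i _; apply: xe; rewrite -ltnS.
Qed.

Lemma omega_seminorm_le j (x : omega) n : (n <= j)%N -> normc (x n) <= p j x.
Proof. by move=> nj; have /omega_seminormP[_] := lexx (p j x); exact. Qed.

Lemma omega_seminormZ_le j (a : R[i]) (x : omega) :
  p j (a *: x) <= normc a * p j x.
Proof.
apply/omega_seminormP; split.
  by rewrite mulr_ge0 ?normc_ge0 ?omega_seminorm_ge0.
move=> n nj; rewrite [_ n](_ : _ = a * x n)// Normc.normcM.
by rewrite ler_wpM2l ?normc_ge0 ?omega_seminorm_le.
Qed.

Lemma omega_is_seminorm j : is_seminorm (@omega_seminorm R j : omega -> R).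
Proof.
split => [x|x y|a x]; first exact: omega_seminorm_ge0.
- apply/omega_seminormP; split; first by rewrite addr_ge0 ?omega_seminorm_ge0.
  move=> n nj; apply: le_trans (normcD_le (x n) (y n)) _.
  by rewrite lerD ?omega_seminorm_le.
- apply/eqP; rewrite eq_le omega_seminormZ_le/=.
  have [->|a0] := eqVneq a 0.
    by rewrite Normc.normc0 mul0r omega_seminorm_ge0.
  rewrite -{1}(scalerK a0 x) scalerK//.
  have na0 : 0 < normc a.
    rewrite lt_neqAle normc_ge0 andbT eq_sym; apply: contra a0 => /eqP.
    by move/Normc.eq0_normc => ->.
  rewrite mulrC -ler_pdivlMr// mulrC -Normc.normcV.
  by apply: le_trans (omega_seminormZ_le _ _ _); rewrite scalerK.
Qed.

Lemma omega_seminorm_nondecreasing : nondecreasing_seminorms (p : nat -> omega -> R).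
Proof.
move=> j k x jk; apply/omega_seminormP; split; first exact: omega_seminorm_ge0.
by move=> n nj; apply: omega_seminorm_le; exact: leq_trans jk.
Qed.

HB.instance Definition _ := hasNbhs.Build omega (seminorm_nbhs p).

HB.instance Definition _ := Nbhs_isNbhsTopological.Build omega
  (seminorm_nbhs_filter omega_is_seminorm omega_seminorm_nondecreasing)
  (@seminorm_nbhs_singleton R omega p omega_is_seminorm)
  (@seminorm_nbhs_nbhs R omega p omega_is_seminorm).

Let omega_add_continuous : continuous (fun x : omega * omega => x.1 + x.2).
Proof.
move=> [x y] A /= /(seminorm_add_nbhs omega_is_seminorm)[B [C [xB yC BC]]].
by exists (B, C) => // -[u v] [/= Bu Cv]; exact: BC.
Qed.

Let omega_scale_continuous :
  continuous (fun z : R[i]^o * omega => z.1 *: z.2).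
Proof.
move=> [k x] A /= /(seminorm_scale_nbhs omega_is_seminorm)[d d0 [B xB dB]].
exists ([set l | normc (k - l) < d], B); last first.
  by move=> [l u] [/= kl Bu]; exact: dB.
split => //=; apply/nbhs_ballP; exists (d%:C)%C.
  by rewrite /= ltcE /= eqxx.
by move=> l; rewrite -ball_normE /= normc_normr ltcR.
Qed.

Let omega_locally_convex :
  exists2 B : set_system omega, (forall b, b \in B -> convex_set b) & basis B.
Proof.
exists [set A | exists x j e, A = [set y | p j (y - x) < e]].
  move=> A; rewrite inE => -[x [j [e ->]]].
  exact: (seminorm_ball_convex omega_is_seminorm).
split.
  move=> A [x [j [e ->]]]; rewrite openE => y ye.
  exact: (seminorm_ball_nbhs omega_is_seminorm).
move=> x A [j [e e0 eA]]; exists [set y | p j (y - x) < e] => //=.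
split; first by exists x, j, e.
by rewrite /= subrr (seminorm0 (omega_is_seminorm j)).
Qed.

(* Despite its name, this factory only provides the uniform structure. *)
HB.instance Definition _ := PreTopologicalLmod_isTvs.Build R[i] omega
  omega_add_continuous omega_scale_continuous omega_locally_convex.
HB.instance Definition _ :=
  PreTopologicalNmodule_isTopologicalNmodule.Build omega omega_add_continuous.
HB.instance Definition _ :=
  TopologicalNmodule_isTopologicalLmodule.Build R[i] omega omega_scale_continuous.
HB.instance Definition _ :=
  Uniform_isTvs.Build R[i] omega omega_locally_convex.

Lemma omega_nbhsE (x : (omega : tvsType R[i])) : nbhs x = seminorm_nbhs p x.
Proof. by []. Qed.

End Omega.

(* Main.v *)
From HB Require Import structures.
Require Import Defs.
From mathcomp Require Import all_boot all_order all_algebra.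
From mathcomp Require Import all_classical all_reals all_analysis.

(** Let X = omega + Y and let T be an operator on X. A continuous seminorm on
omega vanishes on every sequence whose first N terms are zero, for some N
(continuous_seminorm_support). Applied to x |-> q (T (x, 0)).2, with q a
continuous norm on Y, this says that T maps the tail
K_N = {(x, 0) | x_i = 0 for i < N} into omega (tail_into_omega). Here N may be
enlarged, so let N > 0.

Let W_n be the space of the (x, 0) whose first n iterates (x, 0), T (x, 0), ...,
T^(n-1) (x, 0) have zero coordinates of all indices i < N. The W_n decrease, and
each of them is closed and of finite codimension in omega, hence nonzero. Since
W_1 = K_N, the operator T maps W_(n+1) into W_n.

If W_n = W_(n+1) for some n > 0, then T maps W_n into itself, and W_n is proper
because it lies in K_N.

Otherwise, for each n some coordinate i < N of T^n is nonzero somewhere on W_n.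
As T maps W_(n+1) into W_n, an index that works for n + 1 also works for n; so,
there being only N indices, one i works for all n (growing_coord). Then
a_n x = (T^n (x, 0))_i is a sequence of functionals on omega for which there are
vectors u_n with a_n u_n <> 0 and a_k u_n = 0 for k < n. Such functionals are
linearly independent (triangular_free). They involve finitely many coordinates
each, and omega is the full algebraic dual of the space of finitely supported
functionals, so some x has a_0 x = 1 and a_n x = 0 for all n > 0
(dual_sequence). The closed invariant subspace of the z with (T^n z)_i = 0 for
all n > 0 contains (x, 0), hence is nonzero, and it is proper because a_1 is not
zero. *)

Import Order.TTheory GRing.Theory Num.Theory.
Import numFieldNormedType.Exports.

Set Implicit Arguments.
Unset Strict Implicit.
Unset Printing Implicit Defensive.
Local Open Scope classical_set_scope.
Local Open Scope ring_scope.
Local Notation normc := Normc.normc.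

(** * Linear functionals and systems of linear equations *)

(** Zorn's lemma gives a subspace H containing U and maximal among those that
avoid v. Every w is then congruent modulo H to a unique multiple of v, and the
coefficient is the functional. *)
Lemma separating_functional (K : fieldType) (E : lmodType K) (U : set E) (v : E) :
  GRing.submod_closed (mem U) -> ~ U v ->
  exists l : {scalar E}, (forall u, U u -> l u = 0) /\ l v = 1.
Proof.
move=> [U0 Ulin] Uv; rewrite in_setE in U0.
have {}Ulin a u w : U u -> U w -> U (a *: u + w).
  by move=> Uu Uw; have := Ulin a u w; rewrite !in_setE; exact.
(* conditions on U `|` A, not on A, hold for the union of an empty chain too *)
pose lin (A : set E) := forall a u w, A u -> A w -> A (a *: u + w).
pose P (A : set E) := lin (U `|` A) /\ ~ (U `|` A) v.
have [F FP Ftot|A [[Alin Av] Amax]] := @Zorn_bigcup E P.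
  split; last by move=> [//|[B /FP[_ Bv] ?]]; apply: Bv; right.
  move=> a u w [Uu|[B FB Bu]] [Uw|[C FC Cw]].
  - by left; exact: Ulin.
  - have [+ _] := FP _ FC => /(_ a u w (or_introl Uu) (or_intror Cw)).
    by move=> [|?]; [left|right; exists C].
  - have [+ _] := FP _ FB => /(_ a u w (or_intror Bu) (or_introl Uw)).
    by move=> [|?]; [left|right; exists B].
  - have [D [FD Du Dw]] : exists D, [/\ F D, D u & D w].
      by have [/(_ _ Bu) ?|/(_ _ Cw) ?] := Ftot _ _ FB FC; [exists C|exists B].
    have [+ _] := FP _ FD => /(_ a u w (or_intror Du) (or_intror Dw)).
    by move=> [|?]; [left|right; exists D].
set H := U `|` A in Alin Av.
have H0 : H 0 by left.
have HZ a u : H u -> H (a *: u) by move=> Hu; rewrite -[_ *: _]addr0; exact: Alin.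
have HD u w : H u -> H w -> H (u + w) by rewrite -{2}[u]scale1r; exact: Alin.
have HB u w : H u -> H w -> H (u - w).
  by move=> Hu Hw; apply: HD => //; rewrite -scaleN1r; exact: HZ.
(* maximality makes H a hyperplane, complemented by the line through v *)
have Hc w : exists c, H (w - c *: v).
  have [Hw|nHw] := pselect (H w); first by exists 0; rewrite scale0r subr0.
  pose B := [set x | exists h c, H h /\ x = h + c *: w].
  have UB : U `|` B = B.
    by apply/setUidPr => x Ux; exists x, 0; rewrite scale0r addr0; split; [left|].
  have Blin : lin B.
    move=> a _ _ [h [c [Hh ->]]] [k [d [Hk ->]]]; exists (a *: h + k), (a * c + d).
    by split; [exact: Alin|rewrite scalerDr scalerDl scalerA addrACA].
  have [h [c [Hh vE]]] : B v.
    apply: contrapT => nBv; apply: (Amax B); last by rewrite /P UB.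
    split=> [x Ax|BA]; first by exists x, 0; rewrite scale0r addr0; split; [right|].
    by apply: nHw; right; apply: BA; exists 0, 1; rewrite add0r scale1r.
  have c0 : c != 0.
    by apply: contra_notN Av => /eqP c0; rewrite vE c0 scale0r addr0.
  exists c^-1; rewrite vE scalerDr scalerA mulVf// scale1r opprD addrCA subrr addr0.
  by rewrite -scaleNr; exact: HZ.
have cU w c d : H (w - c *: v) -> H (w - d *: v) -> c = d.
  move=> Hwc Hwd; apply: contrapT => /eqP; rewrite -subr_eq0 => cd; apply: Av.
  rewrite -[v]scale1r -(mulVf cd) -scalerA; apply: HZ.
  have := HB _ _ Hwd Hwc.
  by rewrite opprB addrC addrA subrK -scalerBl.
pose l (w : E) : K^o := projT1 (cid (Hc w)).
have lP w : H (w - l w *: v) by rewrite /l; case: cid.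
have llin : linear l.
  move=> a u w; apply: (cU (a *: u + w)); first exact: lP.
  rewrite scalerDl -scalerA opprD addrACA -scalerBr.
  by apply: Alin; exact: lP.
pose L : {scalar E} := HB.pack l (GRing.isLinear.Build _ _ _ _ l llin).
exists L; split=> [u Uu|] /=.
  by apply: (cU u (l u)) => //; rewrite scale0r subr0; left.
by apply: (cU v (l v)) => //; rewrite scale1r subrr.
Qed.

(** Separate [a 0] from the span of the other terms. *)
Lemma dual_functional (K : fieldType) (E : lmodType K) (a : nat -> E) :
  (forall n (c : nat -> K), a 0%N <> \sum_(k < n) c k *: a k.+1) ->
  exists l : {scalar E}, forall n, l (a n) = (n == 0%N)%:R.
Proof.
move=> a0.
pose U := [set u | exists n (c : nat -> K), u = \sum_(k < n) c k *: a k.+1].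
have pad m n (c : nat -> K) : (n <= m)%N -> \sum_(k < n) c k *: a k.+1 =
    \sum_(k < m) (if (k < n)%N then c k else 0) *: a k.+1.
  move=> nm; rewrite (big_ord_widen _ (fun k => c k *: a k.+1) nm) big_mkcond/=.
  by apply: eq_bigr => k _; case: ifP => // _; rewrite scale0r.
have [|[n [c a0E]]|l [lU l1]] := @separating_functional K E U (a 0%N).
- split; rewrite ?in_setE; first by exists 0%N, (fun=> 0); rewrite big_ord0.
  move=> b u w; rewrite !in_setE => -[m [c ->]] [n [d ->]].
  rewrite (pad _ _ _ (leq_maxl m n)) (pad _ _ d (leq_maxr m n)).
  exists (maxn m n), (fun k => b * (if (k < m)%N then c k else 0) +
    (if (k < n)%N then d k else 0)).
  rewrite scaler_sumr -big_split/=.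
  by apply: eq_bigr => k _; rewrite scalerDl scalerA.
- exact: (a0 n c).
- exists l => -[//|n]; apply: lU; exists n.+1, (fun k => (k == n)%:R).
  rewrite big_ord_recr/= eqxx scale1r big1 ?add0r// => k _.
  by rewrite ltn_eqF// scale0r.
Qed.

(** Fewer equations than unknowns: the matrix of the [g i (e j)] has a nonzero
row kernel. *)
Lemma common_kernel (K : fieldType) (E : lmodType K) (I : finType)
    (g : I -> {scalar E}) (m : nat) (e : 'I_m -> E) : (#|I| < m)%N ->
  exists2 v : 'rV[K]_m, v != 0 & forall i, g i (\sum_j v 0 j *: e j) = 0.
Proof.
move=> Im; pose G := \matrix_(j < m, i < #|I|) (g (enum_val i) (e j) : K).
have /matrix0Pn[r [c rc]] : kermx G != 0.
  by rewrite -mxrank_eq0 mxrank_ker -lt0n subn_gt0 (leq_ltn_trans (rank_leq_col G)).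
exists (row r (kermx G)) => [|i]; first by apply/matrix0Pn; exists 0, c; rewrite mxE.
have /matrixP/(_ 0 (enum_rank i)) : row r (kermx G) *m G = 0.
  by apply/sub_kermxP; exact: row_sub.
rewrite !mxE => GE; rewrite linear_sum /= -{}[RHS]GE.
by apply: eq_bigr => j _; rewrite linearZ !mxE /= enum_rankK.
Qed.

Section OmegaFunctionals.
Context {R : realType}.
Local Notation omega := (omega R).

Lemma omega_sumE (I : Type) (r : seq I) (P : pred I) (f : I -> omega) n :
  (\sum_(i <- r | P i) f i) n = \sum_(i <- r | P i) f i n.
Proof. exact: (big_morph (fun x : omega => x n)). Qed.

Definition unit_seq (j : nat) : omega := fun n => (n == j)%:R.

Lemma sum_unit_seqE m (c : nat -> R[i]) n :
  (\sum_(j < m) c j *: unit_seq j) n = if (n < m)%N then c n else 0.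
Proof.
rewrite omega_sumE; case: ifPn => [nm|].
  rewrite (bigD1 (Ordinal nm))//= big1 ?addr0 => [|j jn].
    by rewrite [LHS](_ : _ = c n * (n == n)%:R)// eqxx mulr1.
  rewrite [LHS](_ : _ = c j * (n == j)%:R)//.
  by rewrite [n == j](negbTE _) ?mulr0// eq_sym; exact: jn.
rewrite -leqNgt => mn; apply: big1 => j _.
rewrite [LHS](_ : _ = c j * (n == j)%:R)// gtn_eqF ?mulr0//.
exact: leq_trans mn.
Qed.

Lemma finitely_supported (a : {scalar omega}) N :
  (forall x : omega, (forall n, (n < N)%N -> x n = 0) -> a x = 0) ->
  forall x, a x = \sum_(j < N) x j * a (unit_seq j).
Proof.
move=> aN x; have /aN : forall n, (n < N)%N ->
    (x - \sum_(j < N) x j *: unit_seq j) n = 0.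
  by move=> n nN; rewrite [LHS](_ : _ = x n - (\sum_(j < N) x j *: unit_seq j) n)//
    sum_unit_seqE nN subrr.
rewrite linearB/= => /eqP; rewrite subr_eq0 => /eqP ->.
by rewrite linear_sum; apply: eq_bigr => j _; rewrite linearZ.
Qed.

(** The functional of [dual_functional], taken on the space of all functions from
omega to the scalars, is evaluated at the coordinate functions: its values there
are the terms of the required sequence, because each [a n] is a finite linear
combination of coordinates. *)
Lemma dual_sequence (a : nat -> {scalar omega}) :
  (forall n, exists N, forall x : omega,
     (forall j, (j < N)%N -> x j = 0) -> a n x = 0) ->
  (forall n (c : nat -> R[i]), exists u,
     a 0%N u <> \sum_(k < n) c k * a k.+1 u) ->
  exists x, forall n, a n x = (n == 0%N)%:R.
Proof.
move=> afin afree.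
have [n c|l lE] := @dual_functional _ (omega -> R[i]^o) (fun n => a n : omega -> R[i]^o).
  have [u uE] := afree n c; apply: contra_not uE => /(congr1 (@^~ u)) ->.
  by rewrite fct_sumE.
pose e j : omega -> R[i]^o := @^~ j.
exists (fun j => l (e j)) => n; rewrite -lE.
have [N aN] := afin n.
have anE : (a n : omega -> R[i]^o) = \sum_(j < N) a n (unit_seq j) *: e j.
  apply/funext => x; rewrite (finitely_supported aN) fct_sumE.
  by apply: eq_bigr => j _; rewrite mulrC.
rewrite (finitely_supported aN) [in RHS]anE linear_sum.
by apply: eq_bigr => j _; rewrite linearZ/= mulrC.
Qed.

(** In a relation expressing [a 0], evaluating at the vector attached to the last
term with a nonzero coefficient leaves that term alone. *)
Lemma triangular_free (a : nat -> {scalar omega}) :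
  (forall n, exists2 u, a n u != 0 & forall k, (k < n)%N -> a k u = 0) ->
  forall n (c : nat -> R[i]), exists u, a 0%N u <> \sum_(k < n) c k * a k.+1 u.
Proof.
move=> atri n c; apply: contrapT => /forallNP /= cE.
have {}cE u : a 0%N u = \sum_(k < n) c k * a k.+1 u by exact: contrapT.
have [k0 ck0|c0] := pickP (fun k : 'I_n => c k != 0); last first.
  have [u + _] := atri 0%N; rewrite cE big1 ?eqxx// => k _.
  by have /negbFE/eqP -> := c0 k; rewrite mul0r.
have [k ck kmax] := @arg_maxnP _ k0 (fun k : 'I_n => c k != 0) (fun k => k : nat) ck0.
have [u uk u0] := atri k.+1; have := cE u; rewrite u0// => /esym/eqP.
rewrite (bigD1 k)//= big1 ?addr0 ?mulf_eq0 => [|j jk].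
  by rewrite (negbTE ck) (negbTE uk).
have [jk'|kj] := ltnP j k; first by rewrite u0 ?mulr0.
have [->|/kmax] := eqVneq (c j) 0; first by rewrite mul0r.
by rewrite /= leqNgt ltn_neqAle kj andbT eq_sym jk.
Qed.

End OmegaFunctionals.

(** * Continuity on omega and on the direct sum *)

Section OmegaTopology.
Context {R : realType}.
Local Notation omega := (omega R).

Lemma continuous_normc_coord n : continuous (fun x : omega => normc (x n)).
Proof.
move=> x; apply/(@cvgrPdist_lt _ _ _ _ (nbhs_filter x)) => e e0; rewrite nearE.
exists n, e => // y /= yx; apply: le_lt_trans yx.
apply: le_trans (omega_seminorm_le _ (leqnn n)).
rewrite [(y - x) n](_ : _ = y n - x n)// ler_norml lerNl opprB.
apply/andP; split.
  by rewrite lerBlDr -[X in normc X <= _](subrK (x n)) normcD_le.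
by rewrite lerBlDr normcB_sym -[X in normc X <= _](subrK (y n)) normcD_le.
Qed.

(** A ball of omega contains every sequence that starts with enough zeros, along
with all its multiples, and a seminorm bounded on a line is zero there. *)
Lemma continuous_seminorm_support (g : omega -> R) :
  is_seminorm g -> continuous g ->
  exists N, forall x : omega, (forall n, (n < N)%N -> x n = 0) -> g x = 0.
Proof.
move=> gS gC; have g0 := seminorm0 gS; have [gge _ gZ] := gS.
have : nbhs (0 : omega) [set x | g x < 1].
  by apply: (gC 0 [set t | t < 1]); apply: lt_nbhsl; rewrite g0.
move=> [N [e e0 eg]]; exists N.+1 => x xN.
apply/eqP; rewrite eq_le gge andbT leNgt; apply/negP => gx.
(* this multiple of x has seminorm exactly 1 *)
have : g (((g x)^-1)%:C%C *: x) < 1.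
  apply: eg => /=; apply: le_lt_trans e0; apply/omega_seminormP; split=> // n nN.
  rewrite subr0 [X in normc X](_ : _ = ((g x)^-1)%:C%C * x n)//.
  by rewrite xN// mulr0 Normc.normc0.
by rewrite gZ/= expr0n/= addr0 sqrtr_sqr gtr0_norm ?invr_gt0// mulVf ?ltxx// gt_eqF.
Qed.

End OmegaTopology.

Section OmegaSum.
Context {R : realType} {Y : tvsType R[i]}.
Local Notation X := (omega R * Y)%type.

Lemma continuous_pair0 : continuous (fun x : omega R => (x, 0) : X).
Proof.
move=> x A [[B C] /= [xB C0] BCA].
by apply: filterS xB => u Bu; apply: BCA; split=> //=; exact: nbhs_singleton.
Qed.

Variables (T : {linear X -> X}) (Tcont : continuous T).

Lemma linear_iter k : linear (iter k T).
Proof. by move=> a u v; elim: k => // k /= ->; rewrite linearP. Qed.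

Lemma iter_linear0 k : iter k T 0 = 0.
Proof. by elim: k => // k /= ->; rewrite linear0. Qed.

Lemma continuous_iter k : continuous (iter k T).
Proof.
elim: k => [|k IH] x; first exact: cvg_id.
exact: (continuous_comp (IH x) (@Tcont _)).
Qed.

Definition orbit_coord (k n : nat) (x : omega R) : R[i]^o := (iter k T (x, 0)).1 n.

Let orbit_coord_linear k n : linear (orbit_coord k n).
Proof.
move=> a x y; rewrite /orbit_coord.
rewrite (_ : (a *: x + y, 0) = a *: (x, 0) + (y, 0) :> X) ?linear_iter//.
by congr pair; rewrite [RHS](_ : _ = a *: 0 + 0)// scaler0 addr0.
Qed.
HB.instance Definition _ k n :=
  GRing.isLinear.Build _ _ _ _ (orbit_coord k n) (orbit_coord_linear k n).

Lemma orbit_coord_support k n : exists N, forall x : omega R,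
  (forall j, (j < N)%N -> x j = 0) -> orbit_coord k n x = 0.
Proof.
have [||N gN] := @continuous_seminorm_support R (fun x => normc (orbit_coord k n x)).
- split=> [x|x y|a x]; first exact: normc_ge0.
  + by rewrite linearD normcD_le.
  + by rewrite linearZ Normc.normcM.
- move=> x; apply: (@continuous_comp _ _ _ (fun x => (iter k T (x, 0)).1)
    (fun x => normc (x n))); last exact: continuous_normc_coord.
  apply: (@continuous_comp _ _ _ (fun x => iter k T (x, 0)) fst); last exact: cvg_fst.
  apply: (@continuous_comp _ _ _ (fun x => (x, 0) : X) (iter k T)).
    exact: continuous_pair0.
  exact: continuous_iter.
by exists N => x /gN /Normc.eq0_normc.
Qed.

Lemma closed_orbit_coord k n : closed [set z : X | (iter k T z).1 n = 0].
Proof.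
rewrite (_ : [set _ | _] = (fun z => normc ((iter k T z).1 n)) @^-1` [set 0]).
  apply: closed_comp; last exact: closed_eq.
  move=> z _; apply: (@continuous_comp _ _ _ (fun z => (iter k T z).1)
    (fun x => normc (x n))); last exact: continuous_normc_coord.
  by apply: continuous_comp; [exact: continuous_iter|exact: cvg_fst].
by apply/seteqP; split=> z /= => [->|/Normc.eq0_normc//]; rewrite Normc.normc0.
Qed.

Lemma closed_snd0 : has_continuous_norm Y -> closed [set z : X | z.2 = 0].
Proof.
move=> [q [qS q0] qC].
rewrite (_ : [set _ | _] = (fun z : X => q z.2) @^-1` [set 0]).
  apply: closed_comp; last exact: closed_eq.
  by move=> z _; apply: continuous_comp; [exact: cvg_snd|exact: qC].
by apply/seteqP; split=> z /= => [->|/q0//]; rewrite (seminorm0 qS).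
Qed.

(** This is where the norm of Y enters: a continuous seminorm that is not definite
would only confine the Y-component of T (x, 0) to its kernel. *)
Lemma tail_into_omega : has_continuous_norm Y -> exists N, forall x : omega R,
  (forall n, (n < N)%N -> x n = 0) -> (T (x, 0)).2 = 0.
Proof.
move=> [q [[q0 qD qZ] qsep] qC].
have Tlin (a : R[i]) x y : T (a *: x + y, 0) = a *: T (x, 0) + T (y, 0).
  rewrite -linearP; congr (T (_, _)).
  by rewrite [RHS](_ : _ = a *: 0 + 0)// scaler0 addr0.
have [||N gN] := @continuous_seminorm_support R (fun x => q (T (x, 0)).2).
- split=> [x|x y|a x]; first exact: q0.
  + by have := Tlin 1 x y; rewrite !scale1r => ->; exact: qD.
  + have := Tlin a x 0; rewrite addr0 => ->; rewrite [T (0, 0)]linear0 addr0.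
    exact: qZ.
- move=> x; apply: (@continuous_comp _ _ _ (fun x => (T (x, 0)).2) q); last exact: qC.
  apply: (@continuous_comp _ _ _ (fun x => T (x, 0)) snd); last exact: cvg_snd.
  apply: (@continuous_comp _ _ _ (fun x => (x, 0) : X) T); last exact: Tcont.
  exact: continuous_pair0.
by exists N => x /gN /qsep.
Qed.

End OmegaSum.

(** * The two families of invariant subspaces *)

Section InvariantSubspaces.
Context {R : realType} {Y : tvsType R[i]}.
Local Notation X := (omega R * Y)%type.
Variables (T : {linear X -> X}) (Tcont : continuous T).

(** For N fixed, this is W_n: the argument n counts iterates of T, and only the
first N coordinates of each are constrained. *)
Definition tail_space (N n : nat) : set X :=
  [set z | z.2 = 0 /\
    forall k i, (k < n)%N -> (i < N)%N -> (iter k T z).1 i = 0].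

(** The iterates start at T z and not at z: a point of omega may then have a
nonzero coordinate of index i. With z itself included, the backward shift of omega
would give the zero space for i = 0. *)
Definition coord_orbit_kernel (i : nat) : set X :=
  [set z | forall k, (iter k.+1 T z).1 i = 0].

Lemma tail_space_submod N n : GRing.submod_closed (mem (tail_space N n)).
Proof.
split=> [|a u v]; rewrite !in_setE.
  by split=> // k i _ _; rewrite iter_linear0.
move=> [u0 uE] [v0 vE]; split=> /= [|k i kn iN]; first by rewrite u0 v0 scaler0 addr0.
rewrite linear_iter.
rewrite [LHS](_ : _ = a * (iter k T u).1 i + (iter k T v).1 i)//.
by rewrite uE// vE// mulr0 addr0.
Qed.

Lemma coord_orbit_kernel_submod i : GRing.submod_closed (mem (coord_orbit_kernel i)).
Proof.
split=> [|a u v]; rewrite !in_setE; first by move=> k; rewrite iter_linear0.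
move=> uE vE k.
rewrite linear_iter.
rewrite [LHS](_ : _ = a * (iter k.+1 T u).1 i + (iter k.+1 T v).1 i)//.
by rewrite uE vE mulr0 addr0.
Qed.

Lemma closed_tail_space N n : has_continuous_norm Y -> closed (tail_space N n).
Proof.
move=> Ynorm.
rewrite (_ : tail_space N n = [set z | z.2 = 0] `&`
  \bigcap_(ki in [set ki | (ki.1 < n)%N /\ (ki.2 < N)%N])
    [set z | (iter ki.1 T z).1 ki.2 = 0]).
  apply: closedI; first exact: closed_snd0.
  by apply: closed_bigI => ki _; exact: closed_orbit_coord.
apply/seteqP; split=> z [z0 zE]; split=> //.
  by move=> [k i] [kn iN]; exact: zE.
by move=> k i kn iN; exact: (zE (k, i)).
Qed.

Lemma closed_coord_orbit_kernel i : closed (coord_orbit_kernel i).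
Proof.
rewrite (_ : coord_orbit_kernel i =
    \bigcap_(k in setT) [set z | (iter k.+1 T z).1 i = 0]).
  by apply: closed_bigI => k _; exact: closed_orbit_coord.
by apply/seteqP; split=> z zE; [move=> k _|move=> k]; exact: zE.
Qed.

(** The space is cut out of omega by n * N linear equations. *)
Lemma tail_space_neq0 N n : tail_space N n != [set 0].
Proof.
pose g (ki : 'I_n * 'I_N) : {scalar omega R} := orbit_coord T ki.1 ki.2.
have [v v0 gv] := common_kernel g (fun j : 'I_(#|{: 'I_n * 'I_N}|.+1) => unit_seq j)
  (ltnSn _).
set x := \sum_j _ in gv; apply/eqP => W0.
have : tail_space N n (x, 0).
  by split=> // k i kn iN; exact: (gv (Ordinal kn, Ordinal iN)).
rewrite W0 => -[x0]; move/negP: v0; apply; apply/eqP/rowP => j; rewrite mxE.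
have xE : x = \sum_(j < #|{: 'I_n * 'I_N}|.+1) v 0 (inord j) *: unit_seq j.
  by apply: eq_bigr => l _; rewrite inord_val.
have := sum_unit_seqE #|{: 'I_n * 'I_N}|.+1 (fun j => v 0 (inord j)) j.
by rewrite -xE x0 ltn_ord inord_val.
Qed.

Lemma tail_space_neqT N n : (0 < N)%N -> (0 < n)%N -> tail_space N n != [set: X].
Proof.
move=> N0 n0; apply/eqP => WT.
have [_ /(_ 0%N 0%N n0 N0)/eqP] : tail_space N n (unit_seq 0, 0) by rewrite WT.
by rewrite /= oner_eq0.
Qed.

(** T maps the tail space of index n.+1 into the one of index n; here the two are
equal. *)
Lemma stable_tail_space_invariant N n : has_continuous_norm Y ->
  (forall x, (forall i, (i < N)%N -> x i = 0) -> (T (x, 0)).2 = 0) ->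
  (0 < n)%N -> tail_space N n `<=` tail_space N n.+1 ->
  invariant_subspace T (tail_space N n).
Proof.
move=> Ynorm TN n0 Wst; split; [exact: tail_space_submod|exact: closed_tail_space|].
move=> _ [[x y] /Wst[/= y0 zE] <-]; subst y; split.
  by apply: TN => i iN; exact: (zE 0%N).
by move=> k i kn iN; rewrite -iterSr; exact: zE.
Qed.

Lemma coord_orbit_kernel_invariant i : invariant_subspace T (coord_orbit_kernel i).
Proof.
split; [exact: coord_orbit_kernel_submod|exact: closed_coord_orbit_kernel|].
by move=> _ [z zE <-] k; rewrite -iterSr; exact: zE.
Qed.

(** The triangular hypothesis makes the functionals [orbit_coord T n i]
independent, so that [dual_sequence] yields a nonzero point (x, 0). *)
Lemma free_coord_orbit_kernel i :
  (forall n, exists2 u, orbit_coord T n i u != 0 &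
     forall k, (k < n)%N -> orbit_coord T k i u = 0) ->
  coord_orbit_kernel i != [set 0] /\ coord_orbit_kernel i != [set: X].
Proof.
move=> tri; pose a n : {scalar omega R} := orbit_coord T n i.
have [|x ax] := @dual_sequence R a _ (@triangular_free R a tri).
  by move=> n; exact: orbit_coord_support.
split; apply/eqP => ME.
  have : coord_orbit_kernel i (x, 0) by move=> k; exact: (ax k.+1).
  rewrite ME => -[x0]; have := ax 0%N; rewrite x0 linear0 => /eqP.
  by rewrite eq_sym oner_eq0.
have [u + _] := tri 1%N; rewrite /orbit_coord.
have : coord_orbit_kernel i (u, 0) by rewrite ME.
by move=> /(_ 0%N) ->; rewrite eqxx.
Qed.

(** For each n the strict inclusion provides a coordinate, a priori depending on n.
Coordinates that work for n work for all smaller indices, so if each of the N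
coordinates failed at some [f i], all would fail at the maximum of [f]. *)
Lemma growing_coord N :
  (forall x, (forall i, (i < N)%N -> x i = 0) -> (T (x, 0)).2 = 0) ->
  (forall n, ~ tail_space N n.+1 `<=` tail_space N n.+2) ->
  exists2 i, (i < N)%N & forall n, exists2 z, tail_space N n z & (iter n T z).1 i != 0.
Proof.
move=> TN Wgr.
have down n i : (exists2 z, tail_space N n.+1 z & (iter n.+1 T z).1 i != 0) ->
    exists2 z, tail_space N n z & (iter n T z).1 i != 0.
  move=> [[x y] [/= y0 zE] zn]; subst y; exists (T (x, 0)); last by rewrite -iterSr.
  split; first by apply: TN => j jN; exact: (zE 0%N).
  by move=> k j kn jN; rewrite -iterSr; exact: zE.
have downle m n i : (m <= n)%N ->
    (exists2 z, tail_space N n z & (iter n T z).1 i != 0) ->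
    exists2 z, tail_space N m z & (iter m T z).1 i != 0.
  by move=> mn; rewrite -(subnK mn); elim: (n - m)%N => // d IH /down.
have some n : exists2 i, (i < N)%N &
    exists2 z, tail_space N n.+1 z & (iter n.+1 T z).1 i != 0.
  apply: contrapT => none; apply: (Wgr n) => z [z0 zE]; split=> // k i.
  rewrite ltnS leq_eqVlt => /predU1P[->|kn] iN; last exact: zE.
  apply: contrapT => /eqP zi; apply: none; exists i => //; exists z => //.
apply: contrapT => none.
have {}none (i : 'I_N) : exists n, ~ exists2 z, tail_space N n z & (iter n T z).1 i != 0.
  apply: contrapT => /forallNP ni; apply: none; exists i => // n.
  exact: contrapT.
have /choice[f fE] := none.
have [i iN] := some (\max_i f i)%N.
by move/downle => /(_ _ (leqW (leq_bigmax (Ordinal iN)))); exact: (fE (Ordinal iN)).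
Qed.

End InvariantSubspaces.

Theorem corollary2p2 (R : realType) (Y : tvsType R[i]) (p : nat -> Y -> R)
    (hY : is_frechet p) (hnorm : has_continuous_norm Y) :
  invariant_subspace_property (omega R * Y)%type.
Proof.
move=> T Tcont; have [N0 TN0] := tail_into_omega Tcont hnorm.
pose N := N0.+1.
have TN x : (forall i, (i < N)%N -> x i = 0) -> (T (x, 0)).2 = 0.
  by move=> xN; apply: TN0 => i iN0; apply: xN; exact: ltnW.
have [[n Wst]|/forallNP Wgr] :=
    pselect (exists n, tail_space T N n.+1 `<=` tail_space T N n.+2).
  exists (tail_space T N n.+1); split; first exact: stable_tail_space_invariant.
    exact: tail_space_neq0.
  exact: tail_space_neqT.
have [i iN iE] := growing_coord TN Wgr.
exists (coord_orbit_kernel T i).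
have [|M0 MT] := @free_coord_orbit_kernel _ _ _ Tcont i; last first.
  by split=> //; exact: coord_orbit_kernel_invariant.
move=> n; have [[x y] [/= y0 zE] zn] := iE n; subst y.
by exists x => // k kn; exact: zE.
Qed.
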